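(* Let $R$ be a ring, $I$ a proper ideal of $R$, $M$ an $R$-module and $N$ a submodule of $M$. Then the following statements hold: (1) If $I\ltimes N$ is an sdf-absorbing primary ideal of $R\ltimes M$, then $I$ is an sdf-absorbing primary ideal of $R$. (2) $I$ is an sdf-absorbing primary ideal of $R$ if and only if $I\ltimes M$ is an sdf-absorbing primary ideal of $R\ltimes M$.
   Context: All rings are commutative with identity $1\neq 0$ and all modules are unital. A proper ideal $I$ of a ring $R$ is called sdf-absorbing primary (square-difference factor absorbing primary) if for all $u,v\in R$, $u^{2}-v^{2}\in I$ implies $u-v\in I$ or $(u+v)^{k}\in I$ for some integer $k\geq 1$. For a ring $R$ and an $R$-module $M$, the idealization (trivial extension) of $R$ by $M$ is the commutative ring $R\ltimes M=\{(r,x)\mid r\in R,\ x\in M\}$ with componentwise addition and multiplication $(u,x)(v,y)=(uv,\,uy+vx)$. For an ideal $I$ of $R$ and a submodule $N$ of $M$, $I\ltimes N=\{(r,x)\mid r\in I,\ x\in N\}\subseteq R\ltimes M$. *)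

(* Defs.v *)
From HB Require Import structures.
From mathcomp Require Import all_boot all_algebra.
From mathcomp Require Import boolp classical_sets.

Set Implicit Arguments.
Unset Strict Implicit.
Unset Printing Implicit Defensive.

Import GRing.Theory.
Local Open Scope ring_scope.
Local Open Scope classical_set_scope.

(* Ideals and submodules are arbitrary subsets [I : set R], [N : set M].
   [idealr_closed] requires 1 \notin I, so it means "is a proper ideal". *)
Definition sdf_absorbing_primary (R : comNzRingType) (I : set R) : Prop :=
  idealr_closed [in I] /\
  forall u v : R, u ^+ 2 - v ^+ 2 \in I ->
    u - v \in I \/ exists2 k : nat, (0 < k)%N & (u + v) ^+ k \in I.

(* An alias of the product type, so that its multiplication is not the
   componentwise one that MathComp puts on products of rings. *)
Definition idealization (R : comNzRingType) (M : lmodType R) : Type :=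
  (R * M)%type.

Section IdealizationRing.
Variables (R : comNzRingType) (M : lmodType R).

HB.instance Definition _ := GRing.Zmodule.copy (idealization M) (R * M)%type.

Definition idealization_one : idealization M := (1, 0).

Definition idealization_mul (a b : idealization M) : idealization M :=
  (a.1 * b.1, a.1 *: b.2 + b.1 *: a.2).

Fact idealization_mulA : associative idealization_mul.
Proof.
case=> [u x] [v y] [w z]; rewrite /idealization_mul /=.
congr (_, _); first by rewrite mulrA.
by rewrite !scalerDr !scalerA -addrA [w * u]mulrC [w * v]mulrC.
Qed.

Fact idealization_mulC : commutative idealization_mul.
Proof.
by case=> [u x] [v y]; rewrite /idealization_mul /= mulrC addrC.
Qed.

Fact idealization_mul1 : left_id idealization_one idealization_mul.
Proof.
by case=> [u x]; rewrite /idealization_mul /= mul1r scale1r scaler0 addr0.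
Qed.

Fact idealization_mulDl : left_distributive idealization_mul +%R.
Proof.
case=> [u x] [v y] [w z]; rewrite /idealization_mul /=.
by congr (_, _); rewrite ?mulrDl // scalerDl scalerDr addrACA.
Qed.

Fact idealization_one_neq0 : idealization_one != 0.
Proof. by apply/eqP => -[] /eqP; rewrite oner_eq0. Qed.

HB.instance Definition _ := GRing.Zmodule_isComNzRing.Build (idealization M)
  idealization_mulA idealization_mulC idealization_mul1 idealization_mulDl
  idealization_one_neq0.

Definition ideal_ltimes (I : set R) (N : set M) : set (idealization M) :=
  I `*` N.

End IdealizationRing.

(* Main.v *)
(** The property "sdf-absorbing primary" is stable under preimages by ring
    morphisms, since such a morphism commutes with all the operations in the
    definition.  Along r |-> (r, 0) the ideal I ⋉ N pulls back to I, and along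
    the projection (r, x) |-> r the ideal I pulls back to I ⋉ M. *)

Require Import Defs.
From HB Require Import structures.
From mathcomp Require Import all_boot all_algebra.
From mathcomp Require Import boolp classical_sets.

Set Implicit Arguments.
Unset Strict Implicit.
Unset Printing Implicit Defensive.

Import GRing.Theory.
Local Open Scope ring_scope.
Local Open Scope classical_set_scope.

Lemma sdf_absorbing_primary_preimage (A B : comNzRingType)
    (f : {rmorphism A -> B}) (J : set B) :
  sdf_absorbing_primary J -> sdf_absorbing_primary (f @^-1` J).
Proof.
have memE x : (x \in f @^-1` J) = (f x \in J) by apply/idP/idP; rewrite !inE.
case=> -[J0 J1 JD] Jsdf; split; first split.
- by rewrite /= memE rmorph0.
(* Properness pulls back because [f] is unital: 1 in the preimage would put 1 in [J]. *)
- by rewrite /= memE rmorph1.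
- move=> a u v; rewrite /= !memE => Ju Jv.
  (* The multiplier [a] becomes [f a], an element of [B], so [f] may fail to be surjective, as r |->
     (r, 0) does in general. *)
  by rewrite rmorphD rmorphM; apply: JD.
- move=> u v; rewrite memE rmorphB !rmorphXn => /Jsdf [Juv | [k k_gt0 Juv]].
  + by left; rewrite memE rmorphB.
  + by right; exists k => //; rewrite memE rmorphXn rmorphD.
Qed.

Section IdealizationMorphisms.
Variables (R : comNzRingType) (M : lmodType R).

Definition idealization_inl (r : R) : idealization M := (r, 0).

Fact idealization_inl_additive : zmod_morphism idealization_inl.
Proof. by move=> r s; apply: congr2; rewrite ?subr0. Qed.

Fact idealization_inl_multiplicative : monoid_morphism idealization_inl.
Proof.
(* Both cross terms in the second coordinate are multiples of 0. *)
by split=> // r s; apply: congr2; rewrite //= !scaler0 addr0.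
Qed.

HB.instance Definition _ := GRing.isZmodMorphism.Build R (idealization M)
  idealization_inl idealization_inl_additive.
HB.instance Definition _ := GRing.isMonoidMorphism.Build R (idealization M)
  idealization_inl idealization_inl_multiplicative.

(** Named separately from [fst] so that the morphism instances refer to the ring structure of
    [idealization M]. *)
Definition idealization_fst (a : idealization M) : R := a.1.

Fact idealization_fst_additive : zmod_morphism idealization_fst.
Proof. by []. Qed.

Fact idealization_fst_multiplicative : monoid_morphism idealization_fst.
Proof. by []. Qed.

HB.instance Definition _ := GRing.isZmodMorphism.Build (idealization M) R
  idealization_fst idealization_fst_additive.
HB.instance Definition _ := GRing.isMonoidMorphism.Build (idealization M) R
  idealization_fst idealization_fst_multiplicative.

(** [N 0] gives the inclusion of [I] in the preimage: (r, 0) must have its second coordinate in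
    [N]. *)
Lemma preimage_idealization_inl (I : set R) (N : set M) :
  N 0 -> idealization_inl @^-1` (ideal_ltimes I N) = I.
Proof. by move=> N0; apply/seteqP; split=> r //= [Ir _]. Qed.

Lemma preimage_idealization_fst (I : set R) :
  idealization_fst @^-1` I = ideal_ltimes I [set: M].
Proof. by apply/seteqP; split=> a //= [Ia _]. Qed.

(** The condition [N 0] covers both a submodule and all of [M], so this serves for (1) and for the
    converse in (2). *)
Lemma sdf_absorbing_primary_ltimesl (I : set R) (N : set M) :
  N 0 -> sdf_absorbing_primary (ideal_ltimes I N) -> sdf_absorbing_primary I.
Proof.
move=> N0 /(sdf_absorbing_primary_preimage idealization_inl).
by rewrite preimage_idealization_inl.
Qed.

End IdealizationMorphisms.

Theorem proposition4p1 (R : comNzRingType) (I : set R) (M : lmodType R)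
    (N : set M) (I_ideal : idealr_closed [in I])
    (N_submod : submod_closed [in N]) :
  (sdf_absorbing_primary (ideal_ltimes I N) -> sdf_absorbing_primary I) /\
  (sdf_absorbing_primary I <->
   sdf_absorbing_primary (ideal_ltimes I [set: M])).
Proof.
split.
  by apply: sdf_absorbing_primary_ltimesl; case: N_submod => /set_mem.
(* The converse is the case N = M of (1); the direct implication uses the projection. *)
split; last exact: sdf_absorbing_primary_ltimesl.
move=> /(sdf_absorbing_primary_preimage (@idealization_fst R M)).
by rewrite preimage_idealization_fst.
Qed.
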